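(* Let $\mathrm L$ be an axiomatic extension of $\mathrm{FL}_{\mathrm e}$. Then $\mathrm L$ is semisimple if and only if the formula $(1\wedge p)\vee(1\wedge\neg(1\wedge p)^n)$ is a theorem of $\mathrm L$ for some $n\in\omega$.
   Context: An $\mathrm{FL}_{\mathrm e}$-algebra is an algebra $\langle A,\wedge,\vee,\top,\bot,\cdot,1,\rightarrow,0\rangle$ such that $\langle A,\wedge,\vee,\top,\bot\rangle$ is a bounded lattice with top $\top$ and bottom $\bot$, $\langle A,\cdot,1\rangle$ is a commutative monoid, $x\cdot y\leq z$ iff $y\leq x\rightarrow z$, and $0$ is an arbitrary constant. Notation: $\neg x:=x\rightarrow\bot$, $x^0:=1$, $x^{n+1}:=x^n\cdot x$, and $\neg x^n$ means $\neg(x^n)$. The logic $\mathrm{FL}_{\mathrm e}$ is the consequence relation on formulas in this signature over an infinite set of variables given by: $\Gamma\vdash\varphi$ iff for every $\mathrm{FL}_{\mathrm e}$-algebra $\mathbf A$ and every homomorphism $h$ from the formula algebra to $\mathbf A$, if $1\leq h(\gamma)$ for all $\gamma\in\Gamma$ then $1\leq h(\varphi)$ (this consequence relation is finitary). An axiomatic extension of $\mathrm{FL}_{\mathrm e}$ is a logic obtained by adding to it a set of formulas, together with all their substitution instances, as axioms. A theorem is a formula derivable from the empty set. A theory of a logic $\mathrm L$ is a set of formulas closed under $\vdash_{\mathrm L}$; a theory is simple if it is maximal among theories other than the set of all formulas; $\mathrm L$ is semisimple if every theory of $\mathrm L$ is an intersection of (a possibly empty family of) simple theories. *)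

(* Defs.v *)
From HB Require Import structures.
From mathcomp Require Import all_boot all_order.
From mathcomp Require Import boolp classical_sets cardinality.

Set Implicit Arguments.
Unset Strict Implicit.
Unset Printing Implicit Defensive.

Local Open Scope order_scope.
Local Open Scope classical_set_scope.

(* Classically, the choice structure and the boolean order that MathComp
   imposes on carriers are no restriction; one-element algebras are allowed. *)
HB.mixin Record TBLattice_Monoid_isFLe d T
    of Order.TBLattice d T & monoid.Monoid T := {
  fle_imp : T -> T -> T;
  fle_zero : T;
  fle_mulC : commutative (@monoid.mul T);
  fle_residuation :
    forall x y z : T, ((x * y)%g <= z) = (y <= fle_imp x z)
}.

#[short(type="fleAlgType")]
HB.structure Definition FLeAlg d :=
  { T of TBLattice_Monoid_isFLe d T & Order.TBLattice d T
       & monoid.Monoid T }.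

Inductive formula (V : Type) : Type :=
| fVar of V
| fAnd of formula V & formula V
| fOr of formula V & formula V
| fTop
| fBot
| fMul of formula V & formula V
| fOne
| fImp of formula V & formula V
| fZero.

Arguments fTop {V}.
Arguments fBot {V}.
Arguments fOne {V}.
Arguments fZero {V}.

Definition fNeg (V : Type) (a : formula V) : formula V := fImp a fBot.

Fixpoint fPow (V : Type) (a : formula V) (n : nat) : formula V :=
  if n is m.+1 then fMul (fPow a m) a else fOne.

Fixpoint fSubst (V : Type) (s : V -> formula V) (a : formula V) : formula V :=
  match a with
  | fVar v => s v
  | fAnd b c => fAnd (fSubst s b) (fSubst s c)
  | fOr b c => fOr (fSubst s b) (fSubst s c)
  | fTop => fTop
  | fBot => fBot
  | fMul b c => fMul (fSubst s b) (fSubst s c)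
  | fOne => fOne
  | fImp b c => fImp (fSubst s b) (fSubst s c)
  | fZero => fZero
  end.

Record is_formula_hom (V : Type) d (A : fleAlgType d) (h : formula V -> A) :
    Prop := {
  hom_and : forall a b, h (fAnd a b) = (h a `&` h b)%O;
  hom_or : forall a b, h (fOr a b) = (h a `|` h b)%O;
  hom_top : h fTop = \top;
  hom_bot : h fBot = \bot;
  hom_mul : forall a b, h (fMul a b) = (h a * h b)%g;
  hom_one : h fOne = 1%g;
  hom_imp : forall a b, h (fImp a b) = fle_imp (h a) (h b);
  hom_zero : h fZero = fle_zero
}.

Definition FLe (V : Type) (G : set (formula V)) (a : formula V) : Prop :=
  forall d (A : fleAlgType d) (h : formula V -> A), is_formula_hom h ->
    (forall g, G g -> 1%g <= h g) -> 1%g <= h a.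

Definition consequence (V : Type) := set (formula V) -> formula V -> Prop.

Definition FLe_plus (V : Type) (Ax : set (formula V)) : consequence V :=
  fun G a => FLe (G `|` [set fSubst s b | s in [set: V -> formula V] & b in Ax]) a.

Definition axiomatic_extension (V : Type) (L : consequence V) : Prop :=
  exists Ax : set (formula V), L = FLe_plus Ax.

Definition is_theorem (V : Type) (L : consequence V) (a : formula V) : Prop :=
  L set0 a.

Definition theory (V : Type) (L : consequence V) (T : set (formula V)) : Prop :=
  forall a, L T a -> T a.

Definition simple_theory (V : Type) (L : consequence V)
    (T : set (formula V)) : Prop :=
  [/\ theory L T, T <> setT &
      forall S, theory L S -> S <> setT -> T `<=` S -> S = T].

(* The intersection of the empty family is the set of all formulas. *)
Definition semisimple (V : Type) (L : consequence V) : Prop :=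
  forall T, theory L T ->
    exists2 F : set (set (formula V)),
      F `<=` simple_theory L & T = \bigcap_(S in F) S.

(* Main.v *)
Require Import Defs.
From HB Require Import structures.
From mathcomp Require Import all_boot all_order generic_quotient.
From mathcomp Require Import boolp classical_sets cardinality.

(* Write p' = 1 /\ p. Local deduction (T, f |- g iff T |- f'^n -> g for some n)
   makes a simple theory that omits f contain ~ f'^n for some n. Hence, if L is
   semisimple, the formulas p' -> q and 1 /\ ~ p'^n -> q (n in nat) together
   entail q. Finitely many of them suffice, and as ~ p'^n increases with n, a
   single n does. Substituting p' \/ (1 /\ ~ p'^n) for q turns both remaining
   premises into theorems.
   Conversely, let T omit f. If T, ~ f'^n |- f, then reasoning by cases with the
   excluded middle yields T |- f; so T, ~ f'^n is consistent, and any simple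
   theory above it omits f. *)

Set Implicit Arguments.
Unset Strict Implicit.
Unset Printing Implicit Defensive.

Import Order.TTheory.
Local Open Scope classical_set_scope.
Local Open Scope quotient_scope.
Local Open Scope order_scope.

(** * Arithmetic of products and powers in an algebra *)

Lemma fle_mulCA d (A : fleAlgType d) (x y z : A) :
  (x * (y * z) = y * (x * z))%g.
Proof. by rewrite !mulgA [(x * y)%g]fle_mulC. Qed.

Lemma fle_mulS d (A : fleAlgType d) (x y z t : A) :
  x <= y -> z <= t -> (x * z <= y * t)%g.
Proof.
have mulS (u v w : A) : u <= v -> (w * u <= w * v)%g.
  by rewrite fle_residuation => /le_trans; apply; rewrite -fle_residuation.
move=> lexy lezt; apply: (le_trans (mulS _ _ x lezt)).
by rewrite ![(_ * t)%g]fle_mulC mulS.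
Qed.

(** Multiplication by [x] has a right adjoint, hence preserves joins. *)
Lemma fle_mulU d (A : fleAlgType d) (x y z : A) :
  (x * (y `|` z) = (x * y) `|` (x * z))%g.
Proof.
apply/eqP; rewrite eq_le; apply/andP; split.
  by rewrite fle_residuation leUx -!fle_residuation leUl leUr.
by rewrite leUx !fle_mulS ?leUl ?leUr.
Qed.

Lemma expg_le1 d (A : fleAlgType d) (x : A) n : x <= 1%g -> (x ^+ n <= 1)%g.
Proof.
move=> x1; elim: n => [|n IH]; first by rewrite expg0.
by rewrite expgS -[leRHS]mul1g fle_mulS.
Qed.

Lemma expg_anti d (A : fleAlgType d) (x : A) m n :
  x <= 1%g -> (m <= n)%N -> (x ^+ n <= x ^+ m)%g.
Proof.
move=> x1 /subnKC <-; rewrite expgnDr -[leRHS]mulg1.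
by rewrite fle_mulS ?expg_le1.
Qed.

Lemma expg_ge1 d (A : fleAlgType d) (x : A) n : 1%g <= x -> (1 <= x ^+ n)%g.
Proof.
move=> x1; elim: n => [|n IH]; first by rewrite expg0.
by rewrite expgS -[leLHS]mul1g fle_mulS.
Qed.

(** When the power is expanded, every term other than [y ^+ n] has a factor [x], and its other
    factors are below 1, so it lies below [x]. *)
Lemma expg_joinr d (A : fleAlgType d) (x y : A) n :
  x <= 1%g -> y <= 1%g -> ((x `|` y) ^+ n <= x `|` y ^+ n)%g.
Proof.
move=> x1 y1; elim: n => [|n IH]; first by rewrite !expg0 leUr.
rewrite expgS; apply: le_trans (fle_mulS (lexx _) IH) _.
rewrite fle_mulU leUx; apply/andP; split.
  rewrite (le_trans _ (leUl _ _)) // -[leRHS]mul1g fle_mulS //.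
  by rewrite leUx x1.
rewrite fle_mulC fle_mulU leUx; apply/andP; split.
  by rewrite (le_trans _ (leUl _ _)) // -[leRHS]mul1g fle_mulS ?expg_le1.
by rewrite fle_mulC -expgS leUr.
Qed.

(** * Homomorphisms and a calculus of inequalities *)

Lemma hom_pow (V : Type) d (A : fleAlgType d) (h : formula V -> A) a n :
  is_formula_hom h -> h (fPow a n) = (h a ^+ n)%g.
Proof.
move=> hh; elim: n => [|n IH] /=; first by rewrite (hom_one hh).
by rewrite (hom_mul hh) IH expgSr.
Qed.

Lemma hom_subst (V : Type) d (A : fleAlgType d) (h : formula V -> A) s :
  is_formula_hom h -> is_formula_hom (h \o fSubst s).
Proof. by case=> *; split=> * /=. Qed.

(* Finitarity and the local deduction theorem follow by induction on this
   calculus, which the Lindenbaum algebra [lind] shows complete for [FLe]. *)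
Inductive fle_le (V : Type) (G : set (formula V)) :
  formula V -> formula V -> Prop :=
| LeHyp g : G g -> fle_le G fOne g
| LeRefl a : fle_le G a a
| LeTrans a b c : fle_le G a b -> fle_le G b c -> fle_le G a c
| LeAndl a b : fle_le G (fAnd a b) a
| LeAndr a b : fle_le G (fAnd a b) b
| LeAnd a b c : fle_le G a b -> fle_le G a c -> fle_le G a (fAnd b c)
| LeOrl a b : fle_le G a (fOr a b)
| LeOrr a b : fle_le G b (fOr a b)
| LeOr a b c : fle_le G a c -> fle_le G b c -> fle_le G (fOr a b) c
| LeTop a : fle_le G a fTop
| LeBot a : fle_le G fBot a
| LeMulC a b : fle_le G (fMul a b) (fMul b a)
| LeMulA a b c : fle_le G (fMul a (fMul b c)) (fMul (fMul a b) c)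
| LeMul1 a : fle_le G (fMul fOne a) a
| Le1Mul a : fle_le G a (fMul fOne a)
| LeImp a b c : fle_le G (fMul a b) c -> fle_le G b (fImp a c)
| LeMul a b c : fle_le G b (fImp a c) -> fle_le G (fMul a b) c.

Lemma fle_le_hom (V : Type) (G : set (formula V)) a b :
  fle_le G a b ->
  forall d (A : fleAlgType d) (h : formula V -> A), is_formula_hom h ->
    (forall g, G g -> 1%g <= h g) -> h a <= h b.
Proof.
move=> leab d A h hh hG; elim: leab => {a b} *;
  rewrite ?(hom_and hh) ?(hom_or hh) ?(hom_top hh) ?(hom_bot hh) ?(hom_mul hh)
    ?(hom_one hh) ?(hom_imp hh) ?leIl ?leIr ?leUl ?leUr ?lex1 ?le0x //.
- exact: hG.
- by apply: le_trans; eassumption.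
- by rewrite lexI; apply/andP.
- by rewrite leUx; apply/andP.
- by rewrite fle_mulC.
- by rewrite mulgA.
- by rewrite mul1g.
- by rewrite mul1g.
- by rewrite -fle_residuation -(hom_mul hh).
- by rewrite fle_residuation -(hom_imp hh).
Qed.

Lemma LeMulS (V : Type) (G : set (formula V)) a b c e :
  fle_le G a b -> fle_le G c e -> fle_le G (fMul a c) (fMul b e).
Proof.
have mulS u v w : fle_le G u v -> fle_le G (fMul w u) (fMul w v).
  by move=> uv; apply/LeMul/(LeTrans uv)/LeImp/LeRefl.
move=> ab ce; apply: LeTrans (mulS _ _ a ce) _.
apply: LeTrans (LeMulC _ _ _) (LeTrans (mulS _ _ e ab) _).
exact: LeMulC.
Qed.

Lemma LeMulAr (V : Type) (G : set (formula V)) a b c :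
  fle_le G (fMul (fMul a b) c) (fMul a (fMul b c)).
Proof.
(* Each round moves the last factor to the front and reassociates: (ab)c, (ca)b, (bc)a; a final swap
   gives a(bc). *)
do 2![apply: LeTrans (LeMulC _ _ _) _; apply: LeTrans (LeMulA _ _ _ _) _].
exact: LeMulC.
Qed.

(** * The Lindenbaum algebra of a set of formulas *)

(** Quotients need a choice type; as [V] is arbitrary, the structure comes from classical choice. *)
HB.instance Definition _ (V : Type) := gen_eqMixin (formula V).
HB.instance Definition _ (V : Type) := gen_choiceMixin (formula V).

Definition lind_equiv (V : Type) (G : set (formula V)) : rel (formula V) :=
  fun a b => `[< fle_le G a b /\ fle_le G b a >].

Lemma lind_equivP (V : Type) (G : set (formula V)) :
  equiv_class_of (lind_equiv G).
Proof.
split=> [a|a b|a b c].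
- by apply/asboolP; split; apply: LeRefl.
- by apply/asboolP/asboolP => -[].
move=> /asboolP[ab ba] /asboolP[bc cb].
by apply/asboolP; split; [apply: LeTrans ab bc|apply: LeTrans cb ba].
Qed.

Canonical lind_equiv_rel (V : Type) (G : set (formula V)) :=
  EquivRelPack (lind_equivP G).

Definition lind (V : Type) (G : set (formula V)) := {eq_quot lind_equiv_rel G}.

HB.instance Definition _ (V : Type) (G : set (formula V)) :=
  Choice.on (lind G).

Definition lpi (V : Type) (G : set (formula V)) (a : formula V) : lind G :=
  \pi_(lind G) a.
Arguments lpi {V} G a.

Lemma lpi_eqP (V : Type) (G : set (formula V)) a b :
  fle_le G a b -> fle_le G b a -> lpi G a = lpi G b.
Proof. by move=> ab ba; apply/(@eqmodP _ (lind_equiv_rel G))/asboolP. Qed.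

Lemma lpi_repr (V : Type) (G : set (formula V)) (a : formula V) :
  fle_le G (repr (lpi G a)) a /\ fle_le G a (repr (lpi G a)).
Proof. by apply/asboolP/(@eqmodP _ (lind_equiv_rel G)); rewrite reprK. Qed.

(** Comparing chosen representatives makes the order laws immediate; [lpi_le] shows that the choice
    does not matter. *)
Definition lind_le V (G : set (formula V)) (x y : lind G) : bool :=
  `[< fle_le G (repr x) (repr y) >].

Fact lind_display : Order.disp_t. Proof. exact: Order.Disp tt tt. Qed.

Lemma lpi_surj V (G : set (formula V)) (x : lind G) : exists a, x = lpi G a.
Proof. by exists (repr x); rewrite /lpi reprK. Qed.

Lemma lind_le_refl V (G : set (formula V)) : reflexive (@lind_le V G).
Proof. by move=> x; apply/asboolP/LeRefl. Qed.

Lemma lind_le_anti V (G : set (formula V)) : antisymmetric (@lind_le V G).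
Proof.
move=> x y /andP[/asboolP xy /asboolP yx].
by rewrite -[x]reprK -[y]reprK; apply: lpi_eqP.
Qed.

Lemma lind_le_trans V (G : set (formula V)) : transitive (@lind_le V G).
Proof. by move=> y x z /asboolP xy /asboolP yz; apply/asboolP/(LeTrans xy). Qed.

HB.instance Definition _ V (G : set (formula V)) :=
  Order.Le_isPOrder.Build lind_display (lind G)
    (@lind_le_refl V G) (@lind_le_anti V G) (@lind_le_trans V G).

Lemma lpi_le V (G : set (formula V)) a b :
  (lpi G a <= lpi G b) = `[< fle_le G a b >].
Proof.
have [ra ar] := lpi_repr G a; have [rb br] := lpi_repr G b.
apply/asboolP/asboolP => leab.
  exact: LeTrans ar (LeTrans leab rb).
exact: LeTrans ra (LeTrans leab br).
Qed.

(** Again computed on representatives, so that the universal properties below are single rules of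
    the calculus; compatibility with the quotient is needed only for [lind_mulA], the unit laws and
    [lpi_hom]. *)
Definition lind_op V (G : set (formula V))
    (op : formula V -> formula V -> formula V) (x y : lind G) : lind G :=
  lpi G (op (repr x) (repr y)).

Lemma lind_meetP V (G : set (formula V)) (x y z : lind G) :
  (x <= lind_op (@fAnd V) y z) = (x <= y) && (x <= z).
Proof.
rewrite -[x]reprK -[y in RHS]reprK -[z in RHS]reprK !lpi_le.
apply/asboolP/andP => [xyz|[/asboolP xy /asboolP xz]]; last exact: LeAnd.
by split; apply/asboolP; apply: LeTrans xyz _; [apply: LeAndl|apply: LeAndr].
Qed.

Lemma lind_joinP V (G : set (formula V)) (x y z : lind G) :
  (lind_op (@fOr V) x y <= z) = (x <= z) && (y <= z).
Proof.
rewrite -[x in RHS]reprK -[y in RHS]reprK -[z]reprK !lpi_le.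
apply/asboolP/andP => [xyz|[/asboolP xz /asboolP yz]]; last exact: LeOr.
by split; apply/asboolP; apply: LeTrans xyz; [apply: LeOrl|apply: LeOrr].
Qed.

HB.instance Definition _ V (G : set (formula V)) :=
  Order.POrder_MeetJoin_isLattice.Build lind_display (lind G)
    (@lind_meetP V G) (@lind_joinP V G).

Lemma lind_le0x V (G : set (formula V)) (x : lind G) : lpi G fBot <= x.
Proof. by rewrite -[x]reprK lpi_le; apply/asboolP/LeBot. Qed.

Lemma lind_lex1 V (G : set (formula V)) (x : lind G) : x <= lpi G fTop.
Proof. by rewrite -[x]reprK lpi_le; apply/asboolP/LeTop. Qed.

HB.instance Definition _ V (G : set (formula V)) :=
  Order.hasBottom.Build lind_display (lind G) (@lind_le0x V G).
HB.instance Definition _ V (G : set (formula V)) :=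
  Order.hasTop.Build lind_display (lind G) (@lind_lex1 V G).

Lemma lind_mulE V (G : set (formula V)) a b :
  lind_op (@fMul V) (lpi G a) (lpi G b) = lpi G (fMul a b).
Proof.
have [ra ar] := lpi_repr G a; have [rb br] := lpi_repr G b.
by apply: lpi_eqP; apply: LeMulS.
Qed.

Lemma lind_mulC V (G : set (formula V)) :
  commutative (lind_op (G := G) (@fMul V)).
Proof. by move=> x y; apply: lpi_eqP; apply: LeMulC. Qed.

Lemma lind_mulA V (G : set (formula V)) :
  associative (lind_op (G := G) (@fMul V)).
Proof.
move=> x y z; have [a ->] := lpi_surj x; have [b ->] := lpi_surj y.
have [c ->] := lpi_surj z; rewrite !lind_mulE.
by apply: lpi_eqP; [exact: LeMulA|exact: LeMulAr].
Qed.

Lemma lind_mul1 V (G : set (formula V)) :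
  left_id (lpi G fOne) (lind_op (@fMul V)).
Proof.
move=> x; have [a ->] := lpi_surj x; rewrite lind_mulE.
by apply: lpi_eqP; [apply: LeMul1|apply: Le1Mul].
Qed.

Lemma lind_mulr1 V (G : set (formula V)) :
  right_id (lpi G fOne) (lind_op (@fMul V)).
Proof. by move=> x; rewrite lind_mulC lind_mul1. Qed.

HB.instance Definition _ V (G : set (formula V)) :=
  isMonoid.Build (lind G) (@lind_mulA V G) (@lind_mul1 V G) (@lind_mulr1 V G).

Lemma lind_residuation V (G : set (formula V)) (x y z : lind G) :
  ((x * y)%g <= z) = (y <= lind_op (@fImp V) x z).
Proof.
rewrite -[y in RHS]reprK -[z in LHS]reprK [LHS]lpi_le [RHS]lpi_le.
by apply/asboolP/asboolP => [/LeImp|/LeMul].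
Qed.

HB.instance Definition _ V (G : set (formula V)) :=
  TBLattice_Monoid_isFLe.Build lind_display (lind G) (lpi G fZero)
    (@lind_mulC V G) (@lind_residuation V G).

Lemma lpi_imp V (G : set (formula V)) a b :
  lpi G (fImp a b) = lind_op (@fImp V) (lpi G a) (lpi G b).
Proof.
have [ra ar] := lpi_repr G a; have [rb br] := lpi_repr G b.
apply: lpi_eqP; apply: LeImp.
  apply: LeTrans (LeMulS ra (LeRefl _ _)) _.
  by apply: LeTrans br; apply/LeMul/LeRefl.
apply: LeTrans (LeMulS ar (LeRefl _ _)) _.
by apply: LeTrans rb; apply/LeMul/LeRefl.
Qed.

Lemma lpi_hom V (G : set (formula V)) : is_formula_hom (lpi G).
Proof.
split=> // a b; last exact: lpi_imp.
- have [ra ar] := lpi_repr G a; have [rb br] := lpi_repr G b.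
  apply: lpi_eqP; apply: LeAnd.
  + exact: LeTrans (LeAndl _ _ _) ar.
  + exact: LeTrans (LeAndr _ _ _) br.
  + exact: LeTrans (LeAndl _ _ _) ra.
  + exact: LeTrans (LeAndr _ _ _) rb.
- have [ra ar] := lpi_repr G a; have [rb br] := lpi_repr G b.
  apply: lpi_eqP; apply: LeOr.
  + exact: LeTrans ar (LeOrl _ _ _).
  + exact: LeTrans br (LeOrr _ _ _).
  + exact: LeTrans ra (LeOrl _ _ _).
  + exact: LeTrans rb (LeOrr _ _ _).
- exact/esym/lind_mulE.
Qed.

(** * Completeness, finitarity and local deduction *)

(** Completeness: the Lindenbaum algebra of [G] validates [G] under [lpi G], and its order is
    derivability. Inequalities of the calculus can thus be proved by computing in algebras. *)
Lemma fle_leP V (G : set (formula V)) a b :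
  fle_le G a b <->
  forall d (A : fleAlgType d) (h : formula V -> A), is_formula_hom h ->
    (forall g, G g -> 1%g <= h g) -> h a <= h b.
Proof.
split=> [|H]; first exact: fle_le_hom.
apply/asboolP; rewrite -lpi_le; apply: H => [|g Gg]; first exact: lpi_hom.
by rewrite [_ <= _]lpi_le; apply/asboolP/LeHyp.
Qed.

Lemma FLeP V (G : set (formula V)) a : FLe G a <-> fle_le G fOne a.
Proof.
rewrite fle_leP; split=> H d A h hh hG; have := H d A h hh hG;
  by rewrite (hom_one hh).
Qed.

Lemma fle_le_mono V (G H : set (formula V)) a b :
  G `<=` H -> fle_le G a b -> fle_le H a b.
Proof.
move=> GH /fle_leP leab; apply/fle_leP => d A h hh hH.
by apply: leab => // g /GH /hH.
Qed.

(** Finitarity, in a form that serves both chains in Zorn's lemma and increasing sequences of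
    premises: by induction on the derivation, directedness merges the indices of two
    subderivations. *)
Lemma fle_le_directed V I (P : set I) (G : I -> set (formula V)) a b :
  P !=set0 ->
  (forall i j, P i -> P j -> exists2 k, P k & G i `<=` G k /\ G j `<=` G k) ->
  fle_le (\bigcup_(i in P) G i) a b -> exists2 i, P i & fle_le (G i) a b.
Proof.
move=> [i0 Pi0] dirG; elim=> {a b}.
(* Rules without premises hold at any index. *)
2,4,5,7,8,10-15: by move=> *; exists i0 => //; constructor.
- by move=> g [i Pi Gig]; exists i => //; apply: LeHyp.
- move=> a b c _ [i Pi ab] _ [j Pj bc]; have [k Pk [ik jk]] := dirG i j Pi Pj.
  by exists k => //; apply: LeTrans (fle_le_mono ik ab) (fle_le_mono jk bc).
- move=> a b c _ [i Pi ab] _ [j Pj ac]; have [k Pk [ik jk]] := dirG i j Pi Pj.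
  by exists k => //; apply: LeAnd (fle_le_mono ik ab) (fle_le_mono jk ac).
- move=> a b c _ [i Pi ac] _ [j Pj bc]; have [k Pk [ik jk]] := dirG i j Pi Pj.
  by exists k => //; apply: LeOr (fle_le_mono ik ac) (fle_le_mono jk bc).
- by move=> a b c _ [i Pi ab]; exists i => //; apply: LeImp.
- by move=> a b c _ [i Pi ab]; exists i => //; apply: LeMul.
Qed.

(** Induction on the derivation, where each appeal to [f] costs a factor 1 /\ f. The left side [a]
    is arbitrary because derivations of 1 <= b pass through other inequalities. *)
Lemma deduction V (G : set (formula V)) f a b :
  fle_le (f |` G) a b ->
  exists n, fle_le G (fMul (fPow (fAnd fOne f) n) a) b.
Proof.
have homM d (A : fleAlgType d) (h : formula V -> A) n c : is_formula_hom h ->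
    h (fMul (fPow (fAnd fOne f) n) c) = ((1 `&` h f)%O ^+ n * h c)%g.
  by move=> hh; rewrite (hom_mul hh) hom_pow // (hom_and hh) (hom_one hh).
have powS d (A : fleAlgType d) (x y : A) m n :
    (m <= n)%N -> ((1 `&` x) ^+ n * y <= (1 `&` x) ^+ m * y)%g.
  by move=> mn; rewrite fle_mulS ?expg_anti ?leIl.
elim=> {a b}.
2,4,5,7,8,10-15: by move=> *; exists 0%N;
  apply: LeTrans (LeMul1 _ _) _; constructor.
- move=> g [->|Gg].
    (* The hypothesis [f] itself is used once. *)
    exists 1%N; apply/fle_leP => d A h hh hG.
    by rewrite homM // (hom_one hh) expg1 mulg1 leIr.
  by exists 0%N; apply: LeTrans (LeMul1 _ _) _; apply: LeHyp.
(* Transitivity consumes the factors of both derivations, so exponents add. *)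
- move=> a b c _ [m ab] _ [n bc]; exists (n + m)%N.
  apply/fle_leP => d A h hh hG.
  have := fle_le_hom ab hh hG; have := fle_le_hom bc hh hG; rewrite !homM //.
  move=> bc' ab'; rewrite expgnDr -mulgA; apply: le_trans bc'.
  exact: fle_mulS.
(* Any common upper bound of [m] and [n] would do here, since powers of an element below 1
   decrease. *)
- move=> a b c _ [m ab] _ [n ac]; exists (m + n)%N.
  apply/fle_leP => d A h hh hG.
  have := fle_le_hom ab hh hG; have := fle_le_hom ac hh hG; rewrite !homM //.
  move=> ac' ab'; rewrite (hom_and hh) lexI.
  by rewrite (le_trans (powS _ _ _ _ _ _ (leq_addr n m)) ab')
             (le_trans (powS _ _ _ _ _ _ (leq_addl m n)) ac').
- move=> a b c _ [m ac] _ [n bc]; exists (m + n)%N.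
  apply/fle_leP => d A h hh hG.
  have := fle_le_hom ac hh hG; have := fle_le_hom bc hh hG; rewrite !homM //.
  move=> bc' ac'; rewrite (hom_or hh) fle_mulU leUx.
  by rewrite (le_trans (powS _ _ _ _ _ _ (leq_addr n m)) ac')
             (le_trans (powS _ _ _ _ _ _ (leq_addl m n)) bc').
- move=> a b c _ [n abc]; exists n; apply/fle_leP => d A h hh hG.
  have := fle_le_hom abc hh hG.
  by rewrite !homM // (hom_mul hh) (hom_imp hh) -fle_residuation fle_mulCA.
- move=> a b c _ [n abc]; exists n; apply/fle_leP => d A h hh hG.
  have := fle_le_hom abc hh hG.
  by rewrite !homM // (hom_mul hh) (hom_imp hh) -fle_residuation fle_mulCA.
Qed.

Lemma inconsistency V (G : set (formula V)) f :
  FLe (f |` G) fBot -> exists n, FLe G (fNeg (fPow (fAnd fOne f) n)).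
Proof.
move=> /FLeP /deduction[n nf]; exists n; apply/FLeP/LeImp.
by apply: LeTrans nf; apply/LeRefl.
Qed.

(** * Theories and simple theories of an axiomatic extension *)

Local Open Scope classical_set_scope.

Definition instances V (Ax : set (formula V)) : set (formula V) :=
  [set fSubst s b | s in [set: V -> formula V] & b in Ax].

Lemma FLe_plusE V (Ax G : set (formula V)) a :
  FLe_plus Ax G a = FLe (G `|` instances Ax) a.
Proof. by []. Qed.

Lemma FLe_cut V (G H : set (formula V)) a :
  (forall g, G g -> FLe H g) -> FLe G a -> FLe H a.
Proof. by move=> GH Ga d A h hh hH; apply: Ga => // g /GH; apply. Qed.

Lemma FLe_hyp V (G : set (formula V)) a : G a -> FLe G a.
Proof. by move=> Ga d A h _; apply. Qed.

Lemma FLe_mono V (G H : set (formula V)) a : G `<=` H -> FLe G a -> FLe H a.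
Proof. by move=> GH; apply: FLe_cut => g /GH /FLe_hyp. Qed.

Lemma FLe_bot V (G : set (formula V)) a : FLe G fBot -> FLe G a.
Proof. by move=> /FLeP Gbot; apply/FLeP/(LeTrans Gbot)/LeBot. Qed.

Lemma theory_closure V (Ax G : set (formula V)) :
  theory (FLe_plus Ax) (FLe_plus Ax G).
Proof.
move=> a; apply: FLe_cut => g [//|Ig]; apply: FLe_hyp; by right.
Qed.

Lemma sub_closure V (Ax G : set (formula V)) : G `<=` FLe_plus Ax G.
Proof. by move=> a Ga; apply: FLe_hyp; left. Qed.

Lemma theory_FLe V (Ax T : set (formula V)) a :
  theory (FLe_plus Ax) T -> FLe T a -> T a.
Proof. by move=> thT Ta; apply/thT/(FLe_mono _ Ta)=> b; left. Qed.

Lemma theory_instances V (Ax T : set (formula V)) :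
  theory (FLe_plus Ax) T -> instances Ax `<=` T.
Proof. by move=> thT a Ia; apply/thT/FLe_hyp; right. Qed.

(** Since [fBot] entails everything, being proper amounts to omitting one fixed formula, to which
    finitarity applies. *)
Lemma theory_bot V (Ax T : set (formula V)) :
  theory (FLe_plus Ax) T -> (T fBot <-> T = setT).
Proof.
move=> thT; split=> [Tbot|->//]; apply/seteqP; split=> // a _.
exact/(theory_FLe thT)/FLe_bot/FLe_hyp.
Qed.

(** Lindenbaum's lemma: Zorn's lemma on the sets [X] consistent together with [G]. An inconsistency
    of the union of a chain already occurs in a member, by finitarity. *)
Lemma simple_extension V (Ax G : set (formula V)) :
  ~ FLe_plus Ax G fBot ->
  exists2 S, simple_theory (FLe_plus Ax) S & G `<=` S.
Proof.
move=> consG; pose P X := ~ FLe_plus Ax (G `|` X) fBot.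
have [F FP totF|A [PA maxA]] := @Zorn_bigcup _ P.
  (* For the empty chain the claim is the consistency of [G]. *)
  have [->|F0] := eqVneq F set0; first by rewrite /P bigcup_set0 setU0.
  rewrite /P FLe_plusE => /FLeP leF.
  have [|||X FX leX] := @fle_le_directed _ _ F
    (fun X => (G `|` X) `|` instances Ax) fOne fBot.
  - exact/set0P.
  - move=> X Y FX FY; have subU (X1 X2 : set (formula V)) : X1 `<=` X2 ->
        (G `|` X1) `|` instances Ax `<=` (G `|` X2) `|` instances Ax.
      by move=> X12; apply: setSU; apply: setUS.
    have [XY|YX] := totF X Y FX FY; [exists Y|exists X] => //; split=> //;
      exact: subU.
  - apply: fle_le_mono leF => a [[Ga|[X FX Xa]]|Ia].
    + by have /set0P[X FX] := F0; exists X => //; left; left.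
    + by exists X => //; left; right.
    + by have /set0P[X FX] := F0; exists X => //; right.
  by apply: (FP X FX); apply/FLeP.
exists (FLe_plus Ax (G `|` A)) => [|a Ga]; last by apply: sub_closure; left.
split=> [||S thS ST subS]; first exact: theory_closure.
  by move=> E; apply: PA; rewrite E.
apply/seteqP; split=> // a Sa; apply: sub_closure; right.
(* A formula of [S] outside [A] would make [S] strictly larger than [A], though still consistent
   with [G]. *)
apply: contrapT => Aa; apply: (maxA S).
  split=> [b Ab|SA]; first by apply/subS/sub_closure; right.
  exact/Aa/SA.
move=> Sbot; apply/ST/(theory_bot thS)/thS; apply: FLe_mono Sbot.
by move=> b [[Gb|]|]; [left; apply/subS/sub_closure; left|left|right].
Qed.

(** By maximality, adding [f] to [S] yields the inconsistent theory; local deduction turns this into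
    the negation of a power. *)
Lemma simple_neg V (Ax S : set (formula V)) f :
  simple_theory (FLe_plus Ax) S -> ~ S f ->
  exists n, S (fNeg (fPow (fAnd fOne f) n)).
Proof.
move=> [thS _ maxS] Sf.
have [|n Sn] := @inconsistency V S f; last first.
  by exists n; apply: theory_FLe thS Sn.
have thU := @theory_closure V Ax (f |` S).
have : FLe_plus Ax (f |` S) fBot.
  apply: (theory_bot thU).2; apply: contrapT => neU; apply: Sf.
  have <- : FLe_plus Ax (f |` S) = S.
    by apply: maxS => // a Sa; apply: sub_closure; right.
  by apply: sub_closure; left.
apply: FLe_mono => a [//|/(theory_instances thS)]; by right.
Qed.

(** * From excluded middle to semisimplicity *)

Definition lem_formula V (f : formula V) n : formula V :=
  fOr (fAnd fOne f) (fAnd fOne (fNeg (fPow (fAnd fOne f) n))).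

(** With [c] the negated power, deduction gives (1 /\ c)^m <= f, so 1 <= ((1 /\ f) \/ (1 /\ c))^m <=
    (1 /\ f) \/ (1 /\ c)^m <= f, the middle step being [expg_joinr]. *)
Lemma excluded_middle_cases V (G : set (formula V)) f n :
  FLe G (lem_formula f n) ->
  FLe (fNeg (fPow (fAnd fOne f) n) |` G) f -> FLe G f.
Proof.
set c := fNeg _ => lemG /FLeP /deduction[m cf] d A h hh hG.
have := lemG d A h hh hG; have := fle_le_hom cf hh hG.
rewrite (hom_or hh) !(hom_and hh) (hom_mul hh) hom_pow // (hom_and hh).
rewrite !(hom_one hh) mulg1 => cmf /(expg_ge1 m) /le_trans; apply.
apply: le_trans (expg_joinr _ _ _) _; rewrite ?leIl //.
by rewrite leUx leIr.
Qed.

Lemma lem_semisimple V (Ax : set (formula V)) n :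
  (forall f, FLe (instances Ax) (lem_formula f n)) -> semisimple (FLe_plus Ax).
Proof.
move=> lemAx T thT.
(* The candidate family is the largest possible: all simple theories above [T]. *)
exists [set S | simple_theory (FLe_plus Ax) S /\ T `<=` S].
  by move=> S [].
apply/seteqP; split=> [a Ta S [_]|f capf]; first exact.
apply: contrapT => Tf; pose c := fNeg (fPow (fAnd fOne f) n).
have [|S simS TcS] := @simple_extension V Ax (c |` T).
  move=> bot; apply: Tf; apply: (theory_FLe thT).
  apply: (excluded_middle_cases (n := n)).
    exact: FLe_mono (theory_instances thT) (lemAx f).
  apply: FLe_bot; apply: FLe_mono bot => a [//|/(theory_instances thT)].
  by right.
have [thS ST _] := simS.
have Sf : S f by apply: capf; split=> // a Ta; apply: TcS; right.
have Sc : S c by apply: TcS; left.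
(* Where [f] holds, 1 /\ f equals 1, so [c] evaluates to 1 -> \bot, and its validity forces 1 <=
   \bot. *)
apply: ST; apply/(theory_bot thS)/(theory_FLe thS) => d A h hh hS.
have := hS _ Sc; have := hS _ Sf.
rewrite (hom_imp hh) hom_pow // (hom_and hh) (hom_one hh) => /meet_l ->.
by rewrite expg1n -fle_residuation mul1g (hom_bot hh).
Qed.

(** * From semisimplicity to excluded middle *)

Lemma fSubst_comp V (s t : V -> formula V) a :
  fSubst s (fSubst t a) = fSubst (fSubst s \o t) a.
Proof. by elim: a => //= [a -> b ->|a -> b ->|a -> b ->|a -> b ->]. Qed.

(** Cumulative in [n], so that the union over [n] is directed and finitarity selects a single
    stage. *)
Definition lem_premises V (f q : formula V) n : set (formula V) :=
  fImp (fAnd fOne f) q |`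
  [set fImp (fAnd fOne (fNeg (fPow (fAnd fOne f) k))) q |
    k in [set k | (k <= n)%N]].

(** By semisimplicity it suffices that [q] lies in every simple [S] above the premises. If [S]
    omitted [q], the first premise would exclude [f]; then [S] contains some negated power of 1 /\
    f, and the premise for that power gives [q] after all. *)
Lemma semisimple_entails V (Ax : set (formula V)) f q :
  semisimple (FLe_plus Ax) ->
  FLe_plus Ax (\bigcup_n lem_premises f q n) q.
Proof.
set G := \bigcup_n _ => ssL.
have thG := @theory_closure V Ax G.
have [F simF capF] := ssL _ thG.
rewrite capF => S FS; have simS := simF S FS; have [thS _ _] := simS.
have GS : G `<=` S.
  by move=> g /(@sub_closure _ Ax); rewrite capF; apply.
apply: contrapT => Sq.
have Simp a : S (fImp (fAnd fOne a) q) -> ~ S a.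
  move=> Sa' Sa; apply/Sq/(theory_FLe thS) => d A h hh hS.
  have := hS _ Sa'; have := hS _ Sa.
  rewrite (hom_imp hh) (hom_and hh) (hom_one hh) => /meet_l ->.
  by rewrite -fle_residuation mulg1.
have [|n] := simple_neg (f := f) simS.
  by apply/Simp/GS; exists 0%N => //; left.
by apply/Simp/GS; exists n => //; right; exists n => //=.
Qed.

Lemma semisimple_lem V (Ax : set (formula V)) p q :
  p <> q -> semisimple (FLe_plus Ax) ->
  exists n, FLe (instances Ax) (lem_formula (fVar p) n).
Proof.
move=> pq /(semisimple_entails (f := fVar p) (q := fVar q)) /FLeP leq.
(* Finitarity bounds the exponents occurring in the premises by one [n]. *)
have [|||n _ /FLeP Hn] := @fle_le_directed _ _ setT
  (fun n => lem_premises (fVar p) (fVar q) n `|` instances Ax) fOne (fVar q).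
- by exists 0%N.
- have mono m n : (m <= n)%N ->
      lem_premises (fVar p) (fVar q) m `|` instances Ax `<=`
      lem_premises (fVar p) (fVar q) n `|` instances Ax.
    move=> mn; apply/setSU/setUS => _ [k /= km <-]; exists k => //=.
    exact: leq_trans mn.
  by move=> i j _ _; exists (maxn i j) => //; split; apply: mono;
    rewrite ?leq_maxl ?leq_maxr.
- apply: fle_le_mono leq => a [[n _ Ga]|Ia]; first by exists n => //; left.
  by exists 0%N => //; right.
exists n => d A h hh hI.
(* Replacing [q] by the goal makes every premise valid; [p] is unaffected because it differs from
   [q]. *)
pose s v := if `[< v = q >] then lem_formula (fVar p) n else fVar v.
have hs := hom_subst s hh.
have hq : (h \o fSubst s) (fVar q) = h (lem_formula (fVar p) n).
  by rewrite /= /s asboolT.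
have hp : (h \o fSubst s) (fVar p) = h (fVar p) by rewrite /= /s asboolF.
rewrite -hq; apply: Hn => // g [|[t _ [b Ab <-]]]; last first.
  (* Axiom instances are closed under further substitution. *)
  by rewrite /= fSubst_comp; apply: hI; exists (fSubst s \o t) => //; exists b.
have hlem : h (lem_formula (fVar p) n) =
    Order.join (Order.meet 1%g (h (fVar p))) (Order.meet 1%g
      (fle_imp (Order.meet 1%g (h (fVar p)) ^+ n)%g \bot)).
  rewrite (hom_or hh) !(hom_and hh) (hom_imp hh) hom_pow // (hom_and hh).
  by rewrite (hom_one hh) (hom_bot hh).
case=> [->|[k kn <-]].
  rewrite (hom_imp hs) (hom_and hs) hp hq (hom_one hs) hlem.
  by rewrite -fle_residuation mulg1 leUl.
rewrite (hom_imp hs) (hom_and hs) hq (hom_one hs) (hom_imp hs) (hom_bot hs).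
rewrite (hom_pow _ _ hs) (hom_and hs) (hom_one hs) hp hlem.
rewrite -fle_residuation mulg1 (le_trans _ (leUr _ _)) // leI2 //.
(* For k <= n the power with exponent [n] is the smaller one, and negation reverses this. *)
rewrite -fle_residuation.
apply: (le_trans (fle_mulS (expg_anti _ kn) (lexx _))).
  exact: leIl.
by rewrite fle_residuation.
Qed.

(** * The characterisation of semisimplicity *)

Theorem theorem3p45 (V : Type) (V_infinite : infinite_set [set: V]%classic)
    (p : V) (L : consequence V) (L_ext : axiomatic_extension L) :
  semisimple L <->
  exists n : nat,
    is_theorem L
      (fOr (fAnd fOne (fVar p))
           (fAnd fOne (fNeg (fPow (fAnd fOne (fVar p)) n)))).
Proof.
case: L_ext => Ax ->; rewrite /is_theorem.
under [X in _ <-> X]eq_exists do rewrite FLe_plusE set0U.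
split=> [|[n lemp]].
  (* Infinitely many variables provide the second variable [q] that the substitution argument
     needs. *)
  have [q pq] : exists q, p <> q.
    apply: contrapT => pV; apply: V_infinite.
    apply: (sub_finite_set _ (finite_set1 p)) => q _ /=.
    by apply: contrapT => qp; apply: pV; exists q; apply/nesym.
  exact: semisimple_lem pq.
apply: (lem_semisimple (n := n)) => f d A h hh hI.
(* Only [p] occurs in the theorem, so sending every variable to [f] yields its instance at [f]. *)
have hs := hom_subst (fun=> f) hh.
have := lemp d A _ hs; rewrite /lem_formula.
(* As [n] is a variable, [fSubst] does not compute through [fPow]; both formulas are evaluated in
   [A] and compared there. *)
rewrite !(hom_or hs) !(hom_and hs) !(hom_imp hs) !(hom_pow _ _ hs).
rewrite !(hom_and hs).
rewrite !(hom_or hh) !(hom_and hh) !(hom_imp hh) !(hom_pow _ _ hh).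
rewrite !(hom_and hh).
apply=> _ [t _ [b Ab <-]].
rewrite /= fSubst_comp; apply: hI.
by exists (fSubst (fun=> f) \o t) => //; exists b.
Qed.
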